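(* Let $X=\{1,\dots,m\}$, let $(X,r)$ be an involutive near-rack solution of the Yang-Baxter equation, $r(x,y)=(\sigma_x(y),\tau(x))$, and let $(W_{X,r},c)$ be a braided vector space associated to $(X,r)$, with basis $(w_i)_{i\in X}$ and $c(w_i\otimes w_j)=R_{i,j}\,w_{\sigma_i(j)}\otimes w_{\tau(i)}$, $R_{i,j}\in\Bbbk^\times$. Let $\varphi:W_{X,r}\to W_{X,r}$ be the invertible linear map with $\varphi(w_i)=z_iw_{\tau(i)}$, where $$z_i=\sqrt{\frac{R_{i,\tau(1)}}{R_{\tau(i),1}}}\qquad\text{for all } i\in X.$$ Then $$\tilde c:=(\varphi^{-1}\otimes\mathrm{id})\,c\,(\varphi\otimes\mathrm{id})=(\mathrm{id}\otimes\varphi^{-1})\,c\,(\mathrm{id}\otimes\varphi),$$ hence $(W_{X,r},c)$ is t-equivalent to $(W_{X,\tilde r},\tilde c)$, where $(X,\tilde r)$ is the derived solution of $(X,r)$ and $W_{X,\tilde r}=W_{X,r}$ as vector spaces.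
   Context: $\Bbbk$ is an algebraically closed field of characteristic $0$ and $\Bbbk^\times=\Bbbk\setminus\{0\}$. The symbol $\sqrt{\cdot}$ denotes a chosen square root in $\Bbbk$. A set-theoretical solution of the Yang-Baxter equation is a pair $(X,r)$ with $X$ a non-empty set and $r:X\times X\to X\times X$ a bijection satisfying $(r\times \mathrm{id})(\mathrm{id}\times r)(r\times \mathrm{id})=(\mathrm{id}\times r)(r\times \mathrm{id})(\mathrm{id}\times r)$; write $r(x,y)=(\sigma_x(y),\tau_y(x))$. It is non-degenerate if all $\sigma_x,\tau_x:X\to X$ are bijective, and involutive if $r^2=\mathrm{id}_{X\times X}$. A near-rack solution is a non-degenerate solution for which $\tau_y=\tau$ is independent of $y\in X$, $\tau\neq\mathrm{id}$ and $\tau^2=\mathrm{id}$; so $r(x,y)=(\sigma_x(y),\tau(x))$. Derived solution: for a non-degenerate solution $(X,r)$ put $T(x,y)=(\tau_y(x),y)$; the derived solution is $(X,\tilde r)$ with $\tilde r=TrT^{-1}$. It has the form $\tilde r(x,y)=(x\rhd y,x)$ with $(X,\rhd)$ a rack. A braided vector space $(W_{X,\tilde r},\tilde c)$ associated to it is $\bigoplus_{i\in X}\Bbbk w_i$ with a braiding of the form $\tilde c(w_i\otimes w_j)=q_{ij}\,w_{i\rhd j}\otimes w_i$, $q_{ij}\in\Bbbk^\times$. A braided vector space $(V,c)$ is a vector space $V$ with a linear isomorphism $c:V\otimes V\to V\otimes V$ satisfying $(c\otimes\mathrm{id})(\mathrm{id}\otimes c)(c\otimes\mathrm{id})=(\mathrm{id}\otimes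 c)(c\otimes\mathrm{id})(\mathrm{id}\otimes c)$. For a near-rack solution $(X,r)$ with $X$ finite, a braided vector space $(W_{X,r},c)$ associated to $(X,r)$ is $W_{X,r}=\bigoplus_{i\in X}\Bbbk w_i$ with $c(w_i\otimes w_j)=R_{i,j}w_{\sigma_i(j)}\otimes w_{\tau(i)}$, where the scalars $R_{i,j}\in\Bbbk^\times$ satisfy $$R_{i,j}R_{\tau(i),k}R_{\sigma_i(j),\sigma_{\tau(i)}(k)}=R_{j,k}R_{i,\sigma_j(k)}R_{\tau(i),\tau(j)}\quad\text{for all } i,j,k\in X.$$ Two braided vector spaces $(V,c)$ and $(W,\tilde c)$ are t-equivalent if there are linear isomorphisms $U_n:V^{\otimes n}\to W^{\otimes n}$ for all $n\ge 2$ intertwining the representations of the braid group $\mathbb B_n$ on $V^{\otimes n}$ and $W^{\otimes n}$ given by $c$ and $\tilde c$ (the $i$-th standard generator acts by the braiding on tensor factors $i,i+1$). *)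

(* Defs.v *)
From HB Require Import structures.
From mathcomp Require Import all_boot all_algebra.

Set Implicit Arguments.
Unset Strict Implicit.
Unset Printing Implicit Defensive.

Import GRing.Theory.
Local Open Scope ring_scope.

Section Solutions.
Variables (X : Type) (r : X * X -> X * X).

Definition sigma (x y : X) : X := (r (x, y)).1.
(* [tau_ y x] is \tau_y(x): the subscript comes first. *)
Definition tau_ (y x : X) : X := (r (x, y)).2.

Definition r12 (t : X * X * X) : X * X * X := (r t.1, t.2).
Definition r23 (t : X * X * X) : X * X * X :=
  let p := r (t.1.2, t.2) in (t.1.1, p.1, p.2).

Definition ybe_solution : Prop :=
  [/\ inhabited X, bijective r & r12 \o r23 \o r12 =1 r23 \o r12 \o r23].

Definition nondegenerate : Prop :=
  (forall x, bijective (sigma x)) /\ (forall y, bijective (tau_ y)).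

Definition near_rack (tau : X -> X) : Prop :=
  [/\ ybe_solution, nondegenerate, (forall y, tau_ y =1 tau),
      ~ (tau =1 id) & involutive tau].

End Solutions.

Section Derived.
Variables (X : finType) (r : X * X -> X * X).

Definition derT (p : X * X) : X * X := (tau_ r p.2 p.1, p.2).

(* [finv f] is the inverse of [f] when [f] is injective; [derT] is injective
   as soon as [r] is non-degenerate. *)
Definition derived : X * X -> X * X := derT \o r \o finv derT.

Definition rack_op (x y : X) : X := (derived (x, y)).1.

End Derived.

(* The vector space with basis (w_x)_{x \in X} is {ffun X -> K^o}.  Accordingly
   V (x) V is the space with basis X * X, and the n-th tensor power of V is the
   space with basis the words {ffun 'I_n -> X}. *)
Notation vsp K X := {ffun X -> K^o}.
Notation tpow K X n := {ffun {ffun 'I_n -> X} -> K^o}.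

Section Tensors.
Variable K : fieldType.

Definition w {X : finType} (x : X) : vsp K X := [ffun y => (y == x)%:R].

Definition lin_ext {X Y : finType} (f : X -> vsp K Y) :
    'Hom(vsp K X, vsp K Y) :=
  linfun (fun v : vsp K X => \sum_x v x *: f x).

Definition tens {X Y : finType} (u : vsp K X) (v : vsp K Y) : vsp K (X * Y) :=
  [ffun p => u p.1 * v p.2].

Lemma w_tens (X Y : finType) (x : X) (y : Y) : tens (w x) (w y) = w (x, y).
Proof. by apply/ffunP => -[a b]; rewrite !ffunE -natrM mulnb. Qed.

Definition tensf {X Y X' Y' : finType}
    (f : 'Hom(vsp K X, vsp K X')) (g : 'Hom(vsp K Y, vsp K Y')) :
    'Hom(vsp K (X * Y), vsp K (X' * Y')) :=
  lin_ext (fun p => tens (f (w p.1)) (g (w p.2))).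

Lemma lin_extE (X Y : finType) (f : X -> vsp K Y) v :
  lin_ext f v = \sum_x v x *: f x.
Proof.
have lf : linear (fun v : vsp K X => \sum_x v x *: f x).
  move=> a u t; rewrite scaler_sumr -big_split /=.
  by apply: eq_bigr => x _; rewrite !ffunE scalerDl scalerA.
pose F := HB.pack_for {linear vsp K X -> vsp K Y}
  (fun v : vsp K X => \sum_x v x *: f x) (GRing.isLinear.Build _ _ _ _ _ lf).
exact: (lfunE F v).
Qed.

Lemma lin_ext_w (X Y : finType) (f : X -> vsp K Y) x : lin_ext f (w x) = f x.
Proof.
rewrite lin_extE (bigD1 x) //= ffunE eqxx scale1r big1 ?addr0 // => y /negPf yx.
by rewrite ffunE yx scale0r.
Qed.

Lemma w_sum (X : finType) (v : vsp K X) : v = \sum_x v x *: w x.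
Proof.
apply/ffunP => y; rewrite sum_ffunE (bigD1 y) //= !ffunE eqxx.
rewrite big1 ?addr0 => [|x /negPf xy]; first by rewrite /GRing.scale /= mulr1.
by rewrite !ffunE eq_sym xy scaler0.
Qed.

Lemma tensfE (X Y X' Y' : finType) (f : 'Hom(vsp K X, vsp K X'))
    (g : 'Hom(vsp K Y, vsp K Y')) u v :
  tensf f g (tens u v) = tens (f u) (g v).
Proof.
apply/ffunP => -[a b].
rewrite lin_extE !sum_ffunE [u in RHS]w_sum [v in RHS]w_sum !linear_sum !ffunE /=.
rewrite !sum_ffunE big_distrlr pair_big /=.
apply: eq_bigr => -[x y] _ /=; rewrite !linearZ !ffunE /= /GRing.scale /=.
by rewrite mulrACA.
Qed.

Definition subst2 {X : finType} {n} (t : {ffun 'I_n -> X}) (i j : 'I_n)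
    (p : X * X) : {ffun 'I_n -> X} :=
  [ffun l => if l == i then p.1 else if l == j then p.2 else t l].

(* [c] acting on the tensor factors [i] and [j]; for [j = i.+1] this is
   id^(i) (x) c (x) id^(n-i-2), the action of a standard generator of the braid
   group. *)
Definition act_on {X : finType} (c : 'End(vsp K (X * X))) {n} (i j : 'I_n) :
    'End(tpow K X n) :=
  lin_ext (fun t : {ffun 'I_n -> X} =>
    \sum_p c (w (t i, t j)) p *: w (subst2 t i j p)).

Definition braiding {X : finType} (c : 'End(vsp K (X * X))) : Prop :=
  let c12 := act_on c (@Ordinal 3 0 isT) (@Ordinal 3 1 isT) in
  let c23 := act_on c (@Ordinal 3 1 isT) (@Ordinal 3 2 isT) in
  bijective c /\ (c12 \o c23 \o c12 = c23 \o c12 \o c23)%VF.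

(* The representation of the braid group on a tensor power is determined by the
   standard generators, so intertwining is required of these. *)
Definition t_equivalent {X Y : finType}
    (c : 'End(vsp K (X * X))) (d : 'End(vsp K (Y * Y))) : Prop :=
  [/\ braiding c, braiding d &
    exists U : forall n, 'Hom(tpow K X n, tpow K Y n),
      forall n, (2 <= n)%N -> bijective (U n) /\
        forall i j : 'I_n, j = i.+1 :> nat ->
          (U n \o act_on c i j = act_on d i j \o U n)%VF].

Definition near_rack_braided {X : finType} (r : X * X -> X * X) (tau : X -> X)
    (R : X -> X -> K) (c : 'End(vsp K (X * X))) : Prop :=
  [/\ forall i j, R i j != 0,
      forall i j k,
        R i j * R (tau i) k * R (sigma r i j) (sigma r (tau i) k) =
        R j k * R i (sigma r j k) * R (tau i) (tau j) &
      forall i j, c (tens (w i) (w j)) =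
        R i j *: tens (w (sigma r i j)) (w (tau i))].

Definition rack_braided {X : finType} (op : X -> X -> X)
    (c : 'End(vsp K (X * X))) : Prop :=
  braiding c /\ exists q : X -> X -> K, (forall i j, q i j != 0) /\
    forall i j, c (tens (w i) (w j)) = q i j *: tens (w (op i j)) (w i).

End Tensors.

Arguments w {K X} x.

(* Main.v *)
Require Import Defs.
From mathcomp Require Import all_boot all_algebra.
From mathcomp Require Import ring.

(** Involutivity makes the solution a twisted flip: comparing the components
    of [r (r (x, y)) = (x, y)] gives [tau (sigma_x y) = y], hence
    [sigma_x = tau] and [r (x, y) = (tau y, tau x)]
    ([involutive_near_rackE]).  The derived solution is then the plain flip
    ([derived_near_rack_flip]).

    Every operator involved sends a basis vector to a scalar multiple of a
    basis vector, so it is described by a map of basis indices together with a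
    weight, and an identity of operators splits into an identity of index maps
    and an identity of weights.  Conjugating by [phi] on the first factor turns
    [c] into the flip with weight [z_i / z_j * R (tau i) j]; conjugating on the
    second factor gives the weight [z_j / z_i * R i (tau j)].  They agree
    because, after clearing denominators, [z_i^2 * R (tau i) j =
    z_j^2 * R i (tau j)] is the cocycle condition of [R] at the triple
    [(i, tau j, 1)] ([flip_weight_sym]).

    A weighted flip always satisfies the braid relation.  For the t-equivalence,
    let [U_n] be the tensor product of copies of [phi^-1] and the identity in
    alternation.  Two neighbouring factors carry [phi^-1 (x) id] or
    [id (x) phi^-1], and by the equality of the two conjugates both of them
    intertwine [c] with its conjugate.  This is why both forms of the conjugate
    are needed: either one alone would only handle every other generator. *)

Set Implicit Arguments.
Unset Strict Implicit.
Unset Printing Implicit Defensive.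

Import GRing.Theory.
Local Open Scope ring_scope.

(** * Monomial linear maps *)

Section Monomial.
Variable K : fieldType.
Implicit Types X Y Z : finType.

Definition monomial_map {X Y} (a : X -> K) (f : X -> Y) :
    'Hom(vsp K X, vsp K Y) :=
  lin_ext (fun x => a x *: w (f x)).

Lemma monomial_map_w X Y (a : X -> K) (f : X -> Y) x :
  monomial_map a f (w x) = a x *: w (f x).
Proof. exact: lin_ext_w. Qed.

Lemma eq_lfun_w X Y (f g : 'Hom(vsp K X, vsp K Y)) :
  (forall x, f (w x) = g (w x)) -> f = g.
Proof.
move=> fg; apply/lfunP => v; rewrite [v]w_sum !linear_sum.
by apply: eq_bigr => x _; rewrite !linearZ /= fg.
Qed.

Lemma eq_monomial_map X Y (a b : X -> K) (f g : X -> Y) :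
  a =1 b -> f =1 g -> monomial_map a f = monomial_map b g.
Proof. by move=> ab fg; apply: eq_lfun_w => x; rewrite !monomial_map_w ab fg. Qed.

Lemma monomial_map_comp X Y Z (a : X -> K) (f : X -> Y) (b : Y -> K)
    (g : Y -> Z) :
  (monomial_map b g \o monomial_map a f)%VF =
  monomial_map (fun x => a x * b (f x)) (g \o f).
Proof.
apply: eq_lfun_w => x.
by rewrite comp_lfunE !monomial_map_w linearZ /= monomial_map_w scalerA.
Qed.

Lemma monomial_map1 X : \1%VF = monomial_map (fun _ : X => 1) id.
Proof. by apply: eq_lfun_w => x; rewrite id_lfunE monomial_map_w scale1r. Qed.

Lemma monomial_map_can X Y (a : X -> K) (f : X -> Y) (g : Y -> X) :
  (forall x, a x != 0) -> cancel f g -> cancel g f ->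
  cancel (monomial_map a f) (monomial_map (fun y => (a (g y))^-1) g).
Proof.
move=> a0 fK gK v; rewrite -comp_lfunE monomial_map_comp.
rewrite (_ : monomial_map _ _ = \1%VF) ?id_lfunE //.
rewrite monomial_map1; apply: eq_monomial_map => x /=; last exact: fK.
by rewrite fK divff.
Qed.

Lemma monomial_map_can_sym X Y (a : X -> K) (f : X -> Y) (g : Y -> X) :
  (forall x, a x != 0) -> cancel f g -> cancel g f ->
  cancel (monomial_map (fun y => (a (g y))^-1) g) (monomial_map a f).
Proof.
move=> a0 fK gK v; rewrite -comp_lfunE monomial_map_comp.
rewrite (_ : monomial_map _ _ = \1%VF) ?id_lfunE //.
rewrite monomial_map1; apply: eq_monomial_map => x /=; last exact: gK.
by rewrite mulVf.
Qed.

Lemma monomial_map_bij X Y (a : X -> K) (f : X -> Y) :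
  (forall x, a x != 0) -> bijective f -> bijective (monomial_map a f).
Proof.
move=> a0 [g fK gK]; exists (monomial_map (fun y => (a (g y))^-1) g).
  exact: monomial_map_can.
exact: monomial_map_can_sym.
Qed.

Lemma monomial_map_inv X (a : X -> K) (f g : X -> X) :
  (forall x, a x != 0) -> cancel f g -> cancel g f ->
  (monomial_map a f)^-1%VF = monomial_map (fun y => (a (g y))^-1) g.
Proof.
move=> a0 fK gK; have can_a := monomial_map_can a0 fK gK.
have ker0 : lker (monomial_map a f) == 0%VS by apply/lker0P/can_inj/can_a.
apply/lfunP => v; rewrite -{1}[v](monomial_map_can_sym a0 fK gK).
by rewrite lker0_lfunK.
Qed.

Lemma tensf_monomial X Y X' Y' (a : X -> K) (f : X -> X') (b : Y -> K)
    (g : Y -> Y') :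
  tensf (monomial_map a f) (monomial_map b g) =
  monomial_map (fun p => a p.1 * b p.2) (fun p => (f p.1, g p.2)).
Proof.
apply: eq_lfun_w => -[x y]; rewrite monomial_map_w -!w_tens tensfE !monomial_map_w.
apply/ffunP => -[x' y']; rewrite !ffunE /= /GRing.scale /=; ring.
Qed.

(** * Local operators on words *)

Lemma act_on_monomial X (q : X * X -> K) (s : X * X -> X * X) n (i j : 'I_n) :
  act_on (monomial_map q s) i j =
  monomial_map (fun t : {ffun 'I_n -> X} => q (t i, t j))
               (fun t => subst2 t i j (s (t i, t j))).
Proof.
apply: eq_lfun_w => t; rewrite lin_ext_w !monomial_map_w.
rewrite (bigD1 (s (t i, t j))) //= big1 => [|p /negPf ps].
  by rewrite !ffunE eqxx addr0 /GRing.scale /= mulr1.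
by rewrite !ffunE ps scaler0 scale0r.
Qed.

Let i0 : 'I_3 := @Ordinal 3 0 isT.
Let i1 : 'I_3 := @Ordinal 3 1 isT.
Let i2 : 'I_3 := @Ordinal 3 2 isT.

Lemma eq_word3 X (t u : {ffun 'I_3 -> X}) :
  (t i0, t i1, t i2) = (u i0, u i1, u i2) -> t = u.
Proof.
case=> e0 e1 e2; apply/ffunP => -[[|[|[|//]]] lt3].
- by rewrite (_ : Ordinal lt3 = i0) //; apply: val_inj.
- by rewrite (_ : Ordinal lt3 = i1) //; apply: val_inj.
- by rewrite (_ : Ordinal lt3 = i2) //; apply: val_inj.
Qed.

(** Reading a word of length three as a triple, the first two generators act
    on indices by [r12] and [r23]; so the braid relation is the Yang-Baxter
    equation for the indices and a cocycle condition for the weights. *)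
Lemma monomial_braiding X (q : X * X -> K) (s : X * X -> X * X) :
    (forall p, q p != 0) -> bijective s ->
    r12 s \o r23 s \o r12 s =1 r23 s \o r12 s \o r23 s ->
    let q12 t := q (t.1.1, t.1.2) in
    let q23 t := q (t.1.2, t.2) in
    (forall t, q12 t * q23 (r12 s t) * q12 (r23 s (r12 s t)) =
               q23 t * q12 (r23 s t) * q23 (r12 s (r23 s t))) ->
  braiding (monomial_map q s).
Proof.
move=> q0 s_bij ybe q12 q23 cocycle; split; first exact: monomial_map_bij.
rewrite !act_on_monomial !monomial_map_comp.
apply: eq_monomial_map => t /=.
  have := cocycle (t i0, t i1, t i2).
  by rewrite /q12 /q23 /r12 /r23 /= !ffunE /= -!mulrA.
apply: eq_word3; have := ybe (t i0, t i1, t i2).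
by rewrite /r12 /r23 /= !ffunE [X in (X, _) = _ -> _]surjective_pairing.
Qed.

(** The tensor product, over the positions [l], of the monomial maps with
    weights [e l] and index maps [h l]. *)
Definition word_map {X Y} n (e : nat -> X -> K) (h : nat -> X -> Y) :
    'Hom(tpow K X n, tpow K Y n) :=
  monomial_map (fun t : {ffun 'I_n -> X} => \prod_(l < n) e l (t l))
               (fun t => [ffun l : 'I_n => h l (t l)]).

Lemma word_map_bij X Y n (e : nat -> X -> K) (h : nat -> X -> Y) :
  (forall l x, e l x != 0) -> (forall l, bijective (h l)) ->
  bijective (word_map n e h).
Proof.
move=> e0 h_bij; apply: monomial_map_bij => [t|].
  by apply/prodf_neq0 => l _.
have cardXY : #|{: {ffun 'I_n -> Y}}| = #|{: {ffun 'I_n -> X}}|.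
  by rewrite !card_ffun (bij_eq_card (h_bij 0)).
apply: inj_card_bij; last by rewrite cardXY.
move=> t u /ffunP tu; apply/ffunP => l; have := tu l; rewrite !ffunE.
exact: bij_inj.
Qed.

(** Only the factors at positions [i] and [j] matter: the letters elsewhere are
    fixed by the local operators, so the other factors contribute the same
    weight to both sides. *)
Lemma word_map_act_on X Y n (e : nat -> X -> K) (h : nat -> X -> Y)
    (q : X * X -> K) (s : X * X -> X * X)
    (q' : Y * Y -> K) (s' : Y * Y -> Y * Y) (i j : 'I_n) :
  i != j ->
  (forall x y, (h i (s (x, y)).1, h j (s (x, y)).2) = s' (h i x, h j y)) ->
  (forall x y, q (x, y) * (e i (s (x, y)).1 * e j (s (x, y)).2) =
               e i x * e j y * q' (h i x, h j y)) ->
  (word_map n e h \o act_on (monomial_map q s) i j =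
   act_on (monomial_map q' s') i j \o word_map n e h)%VF.
Proof.
move=> ij hs eq_weight; have ji : j != i by rewrite eq_sym.
rewrite !act_on_monomial !monomial_map_comp.
apply: eq_monomial_map => t /=; last first.
  apply/ffunP => l; rewrite !ffunE -hs.
  by case: eqP => [->//|_]; case: eqP => [->|].
rewrite (bigD1 i) // (bigD1 j) //= [in RHS](bigD1 i) // [in RHS](bigD1 j) //=.
rewrite !ffunE !eqxx (negPf ji).
rewrite [X in _ * (_ * (_ * X)) = _](eq_bigr (fun l : 'I_n => e l (t l)));
  last by move=> l /andP[/negPf li /negPf lj]; rewrite ffunE li lj.
by rewrite mulrA mulrA -(mulrA (q _)) eq_weight mulrAC !mulrA.
Qed.

End Monomial.

(** * Involutive near-rack solutions *)

Section NearRack.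
Variables (X : finType) (r : X * X -> X * X) (tau : X -> X).
Hypotheses (r_near_rack : near_rack r tau) (r_involutive : involutive r).

Let tauK : involutive tau. Proof. by case: r_near_rack. Qed.

Lemma near_rack_tauE x y : tau_ r y x = tau x.
Proof. by case: r_near_rack => _ _ tauE _ _; apply: tauE. Qed.

Lemma involutive_near_rackE p : r p = (tau p.2, tau p.1).
Proof.
case: p => x y /=; have r2 u v : (r (u, v)).2 = tau u by apply: near_rack_tauE.
have := congr1 snd (r_involutive (x, y)).
rewrite {1}[r (x, y)]surjective_pairing r2 /= => r1.
by rewrite [LHS]surjective_pairing r2 -{2}r1 tauK.
Qed.

Lemma derived_near_rack_flip p : derived r p = (p.2, p.1).
Proof.
case: p => x y; rewrite /derived /=.
have TE u v : derT r (u, v) = (tau u, v) by rewrite /derT near_rack_tauE.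
have T_inj : injective (derT r).
  by move=> [a b] [a' b']; rewrite !TE => -[/(inv_inj tauK)-> ->].
have -> : (x, y) = derT r (tau x, y) by rewrite TE tauK.
by rewrite finv_f // involutive_near_rackE /= TE !tauK.
Qed.

End NearRack.

(** * The conjugated braiding *)

(** Here [o] is an arbitrary base point.  The cocycle condition at
    [(i, tau j, o)] relates [R (tau i) j] and [R i (tau j)] up to a factor that
    separates into a function of [i] over the same function of [j]; [z] is a
    square root of that function, so half of the factor can be moved to each
    side. *)
Lemma flip_weight_sym (K : fieldType) (X : Type) (tau : X -> X)
    (R : X -> X -> K) (z : X -> K) (o : X) :
  involutive tau -> (forall i j, R i j != 0) -> (forall i, z i != 0) ->
  (forall i j k, R i j * R (tau i) k * R (tau j) (tau k) =
                 R j k * R i (tau k) * R (tau i) (tau j)) ->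
  (forall i, z i ^+ 2 = R i (tau o) / R (tau i) o) ->
  forall i j, z i / z j * R (tau i) j = z j / z i * R i (tau j).
Proof.
move=> tauK R0 z0 cocycle z2 i j.
have sq : z i ^+ 2 * R (tau i) j = z j ^+ 2 * R i (tau j).
  have := cocycle i (tau j) o; rewrite !z2 !tauK => cyc.
  apply: (mulIf (mulf_neq0 (R0 (tau i) o) (R0 (tau j) o))).
  transitivity (R (tau j) o * R i (tau o) * R (tau i) j); last rewrite -cyc.
    by field; rewrite R0.
  by field; rewrite R0.
apply: (mulIf (mulf_neq0 (z0 i) (z0 j))).
transitivity (z i ^+ 2 * R (tau i) j); last rewrite sq.
  by field; rewrite z0.
by field; rewrite z0.
Qed.

Lemma weighted_flip_braiding (K : fieldType) (X : finType) (q : X * X -> K) :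
  (forall p, q p != 0) -> braiding (monomial_map q (fun p => (p.2, p.1))).
Proof.
move=> q0; apply: monomial_braiding => //=.
- by exists (fun p : X * X => (p.2, p.1)); case.
- by move=> t; rewrite /r12 /r23 /=; ring.
Qed.

Theorem corollary4p4 (K : closedFieldType) (charK : [pchar K] =i pred0)
    (sqrt : K -> K) (sqrtK : forall x, sqrt x ^+ 2 = x)
    (m : nat) (m_gt0 : (0 < m)%N)
    (r : 'I_m * 'I_m -> 'I_m * 'I_m) (tau : 'I_m -> 'I_m)
    (r_near_rack : near_rack r tau) (r_involutive : involutive r)
    (R : 'I_m -> 'I_m -> K) (c : 'End(vsp K ('I_m * 'I_m)%type))
    (c_braided : near_rack_braided r tau R c) :
  let one : 'I_m := Ordinal m_gt0 in
  let z (i : 'I_m) : K := sqrt (R i (tau one) / R (tau i) one) in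
  let phi : 'End(vsp K 'I_m) := lin_ext (fun i => z i *: w (tau i)) in
  let ct : 'End(vsp K ('I_m * 'I_m)%type) :=
    (tensf phi^-1 \1 \o c \o tensf phi \1)%VF in
  [/\ bijective phi,
      ct = (tensf \1 phi^-1 \o c \o tensf \1 phi)%VF,
      rack_braided (rack_op r) ct &
      t_equivalent c ct].
Proof.
move=> one z phi ct.
have rE := involutive_near_rackE r_near_rack r_involutive.
have [[_ r_bij ybe] _ _ _ tauK] := r_near_rack.
case: c_braided => R0 cocycle_sigma cE.
have sigmaE i j : sigma r i j = tau j by rewrite /sigma rE.
have cocycle i j k : R i j * R (tau i) k * R (tau j) (tau k) =
    R j k * R i (tau k) * R (tau i) (tau j).
  by have := cocycle_sigma i j k; rewrite !sigmaE.
have z2 i : z i ^+ 2 = R i (tau one) / R (tau i) one by exact: sqrtK.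
have z0 i : z i != 0.
  by rewrite -sqrf_eq0 z2 mulf_neq0 ?invr_eq0.
have q_sym := flip_weight_sym tauK R0 z0 cocycle z2.
pose q (p : 'I_m * 'I_m) := z p.1 / z p.2 * R (tau p.1) p.2.
pose flip (p : 'I_m * 'I_m) := (p.2, p.1).
have q0 p : q p != 0 by rewrite !mulf_neq0 ?invr_eq0.
have cM : c = monomial_map (fun p => R p.1 p.2) r.
  apply: eq_lfun_w => -[i j].
  by rewrite monomial_map_w -w_tens cE sigmaE rE w_tens.
have phiM : phi = monomial_map z tau by [].
have phiV : phi^-1%VF = monomial_map (fun y => (z (tau y))^-1) tau.
  exact: monomial_map_inv.
have ctM : ct = monomial_map q flip.
  rewrite /ct phiV phiM cM monomial_map1 !tensf_monomial !monomial_map_comp.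
  apply: eq_monomial_map => -[i j] /=; rewrite rE /= ?tauK // /q /=.
  by field; rewrite z0.
have ct_braiding : braiding ct by rewrite ctM; apply: weighted_flip_braiding.
split=> //.
- by apply: monomial_map_bij => //; exists tau.
- rewrite ctM phiV phiM cM monomial_map1 !tensf_monomial !monomial_map_comp.
  apply: eq_monomial_map => -[i j] /=; rewrite rE /= ?tauK // /q /= q_sym.
  by field; rewrite z0.
- split=> //; exists (fun i j => q (i, j)); split=> // i j.
  by rewrite !w_tens ctM monomial_map_w /rack_op
             (derived_near_rack_flip r_near_rack r_involutive).
split=> //.
  rewrite cM; apply: monomial_braiding => //= t; rewrite /r12 /r23 /= !rE /=.
  by rewrite ?tauK cocycle.
(* The factors of even index are [phi^-1], those of odd index the identity. *)
exists (fun n => word_map n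
  (fun l x => if odd l then 1 else (z (tau x))^-1)
  (fun l x => if odd l then x else tau x)) => n _; split.
  apply: word_map_bij => l; last by case: odd; [exists id | exists tau].
  by move=> x; case: ifP => _; rewrite ?oner_eq0 ?invr_eq0.
move=> i j ij; rewrite ctM {1}cM; apply: word_map_act_on.
- by rewrite -val_eqE /= ij ltn_eqF.
- by move=> x y; rewrite rE ij /=; case: odd; rewrite /= ?tauK.
move=> x y; rewrite rE ij /= /q; case: odd; rewrite /= ?tauK.
  by rewrite q_sym tauK; field; rewrite !z0.
by field; rewrite !z0.
Qed.
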